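(* The following are equivalent. (1) Every productively quasi-Lindelöf space is powerfully quasi-Lindelöf. (2) Every productively Lindelöf space is powerfully Lindelöf. (3) Every zero-dimensional productively Lindelöf space is powerfully Lindelöf.
   Context: A space is an arbitrary topological space unless separation axioms are stated. A space is quasi-Lindelöf if every open cover of it has a countable subcover (no separation axioms). A space is Lindelöf if it is regular (which includes $\mathsf{T}_1$) and quasi-Lindelöf. A space $X$ is productively Lindelöf (respectively productively quasi-Lindelöf) if $X\times Y$ is Lindelöf (respectively quasi-Lindelöf) for every Lindelöf space $Y$; in both cases $Y$ ranges over Lindelöf, hence regular, spaces. A space $X$ is powerfully Lindelöf (respectively powerfully quasi-Lindelöf) if $X^\omega$ with the product topology is Lindelöf (respectively quasi-Lindelöf). A non-empty space is zero-dimensional if it is $\mathsf{T}_1$ and has a base consisting of clopen sets. *)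

(* Defs.v *)
From mathcomp Require Import all_boot all_order.
From mathcomp Require Import all_classical.
From mathcomp Require Import topology.

Set Implicit Arguments.
Unset Strict Implicit.
Unset Printing Implicit Defensive.

Local Open Scope classical_set_scope.

Definition quasi_lindelof (X : topologicalType) : Prop :=
  forall C : set (set X), C `<=` open -> \bigcup_(U in C) U = [set: X] ->
  exists D : set (set X),
    [/\ D `<=` C, countable D & \bigcup_(U in D) U = [set: X]].

(* The library's [regular_space] does not include T1 ([accessible_space]). *)
Definition lindelof (X : topologicalType) : Prop :=
  [/\ regular_space X, accessible_space X & quasi_lindelof X].

Definition productively_lindelof (X : topologicalType) : Prop :=
  forall Y : topologicalType, lindelof Y -> lindelof (X * Y)%type.

(* [Y] ranges over Lindelöf, hence regular, spaces also in this case. *)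
Definition productively_quasi_lindelof (X : topologicalType) : Prop :=
  forall Y : topologicalType, lindelof Y -> quasi_lindelof (X * Y)%type.

Definition powerfully_lindelof (X : topologicalType) : Prop :=
  lindelof {ptws nat -> X}.

Definition powerfully_quasi_lindelof (X : topologicalType) : Prop :=
  quasi_lindelof {ptws nat -> X}.

(* Not the library's [zero_dimensional], which only asks that distinct points
   be separated by clopen sets. *)
Definition zero_dimensional_space (X : topologicalType) : Prop :=
  [/\ [set: X] !=set0,
      accessible_space X
    & exists2 B : set (set X), basis B & B `<=` clopen].

(* Main.v *)
Require Import Defs.
From mathcomp Require Import all_boot all_order.
From mathcomp Require Import all_classical.
From mathcomp Require Import topology.

(** Going from T1 regular spaces to arbitrary ones is the only substantial
implication, and it rests on coding a space [X] by a zero-dimensional one.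

A point [x] of [X] is represented by its neighbourhood filter, a point of the
Cantor cube 2^P(X) whose coordinates are indexed by the subsets of [X].  The set
of these codes inherits from the cube a topology that is in general finer than
that of [X], so that covering properties need not survive; it is therefore
enlarged to the set [Z] of all [A] that contain the neighbourhood filter of some
point of [X] ([nbhs_hull]).  Like every nonempty subspace of the cube, [Z] is
zero-dimensional.

- [Z] inherits productivity.  The relation
  {(x, A) | every neighbourhood of x belongs to A} is closed in X * 2^P(X)
  and projects onto [Z].  If X * Y is quasi-Lindelof then so is its product with
  the compact cube, hence so is the closed set of all (x, y, A) with (x, A) in
  the relation, hence so is its continuous image Z * Y
  ([quasi_lindelof_prod_nbhs_hull]).

- [X] inherits powers.  A basic open box in a power of [X] restricts finitely
  many coordinates x_i to lie in sets U_i, and corresponds to the clopen box of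
  those sequences in [Z] whose i-th term contains U_i.  If boxes cover the power
  of [X], the corresponding ones cover the power of [Z], since every term of a
  sequence in [Z] contains the neighbourhood filter of some point; and a
  subcover, evaluated at sequences of codes, gives a subcover of the power of
  [X] ([quasi_lindelof_ptws_nbhs_hull]).

Both transfers are instances of [quasi_lindelof_pullback].  In the other
direction, a productively Lindelof space and all its powers are regular and T1,
so that only quasi-Lindelofness of the power is at stake. *)

Set Implicit Arguments.
Unset Strict Implicit.
Unset Printing Implicit Defensive.

Local Open Scope classical_set_scope.

(** * Quasi-Lindelof spaces *)

(** Indexed families of sets that are merely neighbourhoods are easier to
transport between spaces than sets of open sets: the index, unlike the set, is
unchanged by the transport. *)
Lemma quasi_lindelof_family (X : topologicalType) :
  quasi_lindelof X <->
  forall (I : Type) (V : I -> set X),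
    (forall x : X, exists i, nbhs x (V i)) ->
  exists2 S : set I, countable S & forall x, exists2 i, S i & V i x.
Proof.
split=> [qX I V Vnbhs | famX C Copen Ccov].
  have [_ [i _ <-]||D [DC Dct Dcov]] := qX [set interior (V i) | i in setT].
  - exact: open_interior.
  - rewrite -subTset => x _; have [i xVi] := Vnbhs x.
    by exists (interior (V i)) => //; exists i.
  have [[i0]|I0] := pselect (inhabited I); last first.
    exists set0 => [|x]; first exact: countable0.
    by have [i _] := Vnbhs x; case: I0.
  have /choice[g gE] : forall U, exists i, D U -> interior (V i) = U.
    move=> U; have [DU|] := pselect (D U); last by exists i0.
    by have [i _ iU] := DC _ DU; exists i.
  exists (g @` D) => [|x]; first exact: card_le_trans (card_image_le _ _) Dct.
  have [U DU Ux] : (\bigcup_(U in D) U) x by rewrite Dcov.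
  exists (g U); first by exists U.
  by apply: interior_subset; rewrite gE.
have [x|S Sct Scov] := famX {U | C U} (fun U => sval U).
  have [U CU Ux] : (\bigcup_(U in C) U) x by rewrite Ccov.
  by exists (exist _ U CU); apply: open_nbhs_nbhs; split; first exact: Copen.
exists (sval @` S); split.
- by move=> _ [[U CU] _ <-].
- exact: card_le_trans (card_image_le _ _) Sct.
- rewrite -subTset => x _; have [U SU Ux] := Scov x.
  by exists (sval U) => //; exists U.
Qed.

Lemma quasi_lindelof_countable (X : topologicalType) :
  countable [set: X] -> quasi_lindelof X.
Proof.
move=> Xct; apply/quasi_lindelof_family => I V /choice[g gV].
exists (range g); first exact: card_le_trans (card_image_le _ _) Xct.
by move=> x; exists (g x); [exists x | exact: nbhs_singleton (gV x)].
Qed.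

Lemma filter_preimage_nbhs (X : Type) (Y : topologicalType) (phi : X -> Y)
    (y : Y) : Filter (filter_from (nbhs y) (preimage phi)).
Proof.
apply: filter_from_filter; first by exists setT; exact: filterT.
by move=> A B yA yB; exists (A `&` B) => //; exact: filterI.
Qed.

(** What matters is not continuity of [phi] but a converse to it: whenever
[phi] tends to some [y], its argument must converge in [X].  Then the members of
a family that surround the limits in [X] yield neighbourhoods of the points [y].
For instance, every section of a continuous map onto [X] from a closed subspace
of [Y] has this property; in general the limit in [X] need not depend
continuously on [y]. *)
Lemma quasi_lindelof_pullback (X Y : topologicalType) (phi : X -> Y) :
  (forall y : Y, filter_from (nbhs y) (preimage phi) set0 \/
     exists x : X, filter_from (nbhs y) (preimage phi) --> x) ->
  quasi_lindelof Y -> quasi_lindelof X.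
Proof.
move=> phiP /quasi_lindelof_family qY.
apply/quasi_lindelof_family => I V Vnbhs.
(* The index None stands for the points of Y that are away from the range. *)
pose W (j : option I) : set Y :=
  if j is Some i then [set y | forall x, phi x = y -> V i x]
  else ~` range phi.
have [y|S Sct Scov] := qY _ W.
  have [[N yN N0]|[x Fx]] := phiP y.
    exists None; apply: filterS yN => y' Ny' [x _ xy'].
    by apply: (N0 x); rewrite /preimage /= xy'.
  have [i xVi] := Vnbhs x; have [N yN NV] := Fx _ xVi.
  exists (Some i); apply: filterS yN => y' Ny' x' x'y'; apply: NV.
  by rewrite /preimage/= x'y'.
exists (Some @^-1` S).
  have Some_inj : {in Some @^-1` S &, injective (@Some I)} by move=> i j _ _ [].
  rewrite -(eq_countable (inj_card_eq Some_inj)).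
  by apply: sub_countable Sct; apply: subset_card_le => _ [i Si <-].
move=> x; have [[i|] Sj /= Wx] := Scov (phi x).
  by exists i => //; exact: Wx.
by case: Wx; exists x.
Qed.

(** The tube lemma: each slice over [x] is covered by countably many members of
the family (even finitely many), and they cover the slices over all points near
[x]. *)
Lemma quasi_lindelof_prod_compact (X K : topologicalType) :
  compact [set: K] -> quasi_lindelof X -> quasi_lindelof (X * K)%type.
Proof.
move=> /compact_near_coveringP cK /quasi_lindelof_family qX.
apply/quasi_lindelof_family => I V Vnbhs.
pose W (S : set I) : set X :=
  [set x | countable S /\ forall k, exists2 i, S i & V i (x, k)].
have [x|S Sct Scov] := qX _ W.
  (* Along F, a set of indices eventually contains any given countable set. *)
  pose F : set_system (set I) :=
    filter_from [set S0 | countable S0] (fun S0 => [set S | S0 `<=` S]).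
  have FF : Filter F.
    apply: filter_from_filter; first by exists set0; exact: countable0.
    move=> A B Act Bct; exists (A `|` B).
      by rewrite -bigcup2E; apply: bigcup_countable => // -[|[|n]].
    by move=> S ABS; split=> i ?; apply: ABS; [left|right].
  have [k _|[A Q] /= [xA [S0 S0ct S0Q]] AQ] :=
      cK _ (filter_prod (nbhs x) F)
        (fun q k => exists2 i, q.2 i & V i (q.1, k)) _.
    have [i [[A B] /= [xA kB] ABV]] := Vnbhs (x, k).
    exists (B, A `*` [set S | S i]); first split => //=.
      exists (A, [set S | S i]) => //; split=> //=.
      by exists [set i] => [|S]; [exact: countable1|apply].
    by move=> [k' [x' S]] /= [Bk' [Ax' Si]]; exists i => //; apply: ABV.
  exists S0; apply: filterS xA => x' Ax'; split=> // k.
  by apply: (AQ (x', S0)) => //; split => //; exact: S0Q.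
exists (\bigcup_(S0 in S `&` [set S0 | countable S0]) S0).
  apply: bigcup_countable => [|S0 []//].
  by apply: sub_countable Sct; apply: subset_card_le; exact: subIsetl.
move=> [x k]; have [S0 SS0 [S0ct /(_ k)[i S0i Vi]]] := Scov x.
by exists i => //; exists S0.
Qed.

(** * Permanence of separation axioms *)

(** Regularity says that [filter_from (nbhs x) closure] converges to [x].  This
filter is carried along continuous maps, so any topology whose convergence is
tested by maps into regular spaces is regular: this is how products and powers
are handled below. *)
Lemma cvg_closure_nbhs (X Y : topologicalType) (f : X -> Y) (x : X) :
  regular_space Y -> continuous f ->
  f @ filter_from (nbhs x) closure --> f x.
Proof.
move=> regY fc V /regY[W fxW WV]; exists (f @^-1` W); first exact: fc.
move=> x' clx'; apply: WV => U /fc x'U.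
by have [z [Wz Uz]] := clx' _ x'U; exists (f z).
Qed.

Lemma filter_closure_nbhs (X : topologicalType) (x : X) :
  Filter (filter_from (nbhs x) closure).
Proof.
apply: filter_from_filter; first by exists setT; exact: filterT.
by move=> A B xA xB; exists (A `&` B); [exact: filterI | exact: closureI].
Qed.

Lemma accessible_injective (X : topologicalType) (I : Type)
    (Y : I -> topologicalType) (f : forall i, X -> Y i) :
  (forall i, accessible_space (Y i)) -> (forall i, continuous (f i)) ->
  (forall x x', (forall i, f i x = f i x') -> x = x') -> accessible_space X.
Proof.
move=> T1Y fc finj x y xy.
have [i /eqP/(T1Y i)[A [oA /set_mem Ax /set_mem Ay]]] :
    exists i, f i x <> f i y.
  by apply/existsNP => /finj /eqP; rewrite (negPf xy).
exists (f i @^-1` A); split; rewrite ?inE //.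
by apply: open_comp => // z _; exact: fc.
Qed.

Lemma cvg_prod (X Y : topologicalType) (F : set_system (X * Y)) (p : X * Y) :
  Filter F -> fst @ F --> p.1 -> snd @ F --> p.2 -> F --> p.
Proof.
move=> FF F1 F2 V [[A B] /= [pA pB] AB]; apply: filterS AB _.
by apply: filterI; [exact: F1 | exact: F2].
Qed.

Lemma cvg_initial (S : choiceType) (T : topologicalType) (f : S -> T)
    (F : set_system S) (s : initial_topology f) :
  Filter F -> f @ F --> f s -> F --> s.
Proof.
move=> FF Fs V [_ [[A oA <-] As] AV]; apply: filterS AV _.
by apply: Fs; exact: open_nbhs_nbhs.
Qed.

Lemma cvg_ptws (I : Type) (X : topologicalType) (F : set_system {ptws I -> X})
    (f : {ptws I -> X}) :
  Filter F -> (forall i, (fun g : {ptws I -> X} => g i) @ F --> f i) -> F --> f.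
Proof.
move=> FF Ff; apply/cvg_sup => i.
by apply: (@cvg_initial _ _ (fun g : {ptws I -> X} => g i)) => //; exact: Ff.
Qed.

Lemma proj_ptws_continuous (I : Type) (X : topologicalType) (i : I) :
  continuous (fun g : {ptws I -> X} => g i).
Proof. exact: (@proj_continuous {classic I} (fun=> X) i). Qed.

Lemma regular_prod (X Y : topologicalType) :
  regular_space X -> regular_space Y -> regular_space (X * Y)%type.
Proof.
move=> regX regY p; have FF := filter_closure_nbhs p.
apply: cvg_prod; apply: cvg_closure_nbhs => // q.
  exact: cvg_fst.
exact: cvg_snd.
Qed.

Lemma regular_ptws (I : Type) (X : topologicalType) :
  regular_space X -> regular_space {ptws I -> X}.
Proof.
move=> regX f; have FF := filter_closure_nbhs f.
apply: cvg_ptws => i.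
apply: (@cvg_closure_nbhs _ _ (fun g : {ptws I -> X} => g i)) => //.
exact: proj_ptws_continuous.
Qed.

Lemma regular_prodl (X Y : topologicalType) (y : Y) :
  regular_space (X * Y)%type -> regular_space X.
Proof.
move=> regXY x; have FF := filter_closure_nbhs x.
have paircts : continuous (fun x : X => (x, y)).
  by move=> x'; apply: cvg_pair; [exact: cvg_id | exact: cvg_cst].
have /(cvg_app fst)/cvg_trans := cvg_closure_nbhs (x := x) regXY paircts.
by apply; apply: cvg_fst.
Qed.

Lemma accessible_prod (X Y : topologicalType) :
  accessible_space X -> accessible_space Y -> accessible_space (X * Y)%type.
Proof.
move=> T1X T1Y.
apply: (@accessible_injective _ bool (fun b => if b then X else Y)
  (fun b => if b return X * Y -> (if b then X else Y) then fst else snd)).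
- by case.
- by case=> p; [exact: cvg_fst | exact: cvg_snd].
- by move=> [x y] [x' y'] xy; have /= -> := xy true; have /= -> := xy false.
Qed.

Lemma accessible_ptws (I : Type) (X : topologicalType) :
  accessible_space X -> accessible_space {ptws I -> X}.
Proof.
move=> T1X; apply: (@accessible_injective {ptws I -> X} I (fun=> X)
  (fun i g => g i)) => //.
  by move=> i; exact: proj_ptws_continuous.
by move=> f g; exact: funext.
Qed.

Lemma accessible_prodl (X Y : topologicalType) (y : Y) :
  accessible_space (X * Y)%type -> accessible_space X.
Proof.
move=> T1; apply: (@accessible_injective _ unit (fun=> X * Y)%type
  (fun=> fun x => (x, y))) => //.
  by move=> _ x'; apply: cvg_pair; [exact: cvg_id | exact: cvg_cst].
by move=> x x' /(_ tt) [].
Qed.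

Lemma accessible_discrete (X : discreteTopologicalType) : accessible_space X.
Proof.
move=> x y xy; exists [set x]; split; rewrite ?inE//.
  exact: discrete_open.
by move=> /= yx; rewrite yx eqxx in xy.
Qed.

Lemma lindelof_bool : lindelof bool.
Proof.
split; [exact: uniform_regular | exact: accessible_discrete |].
exact/quasi_lindelof_countable/countableP.
Qed.

(** * The coding space *)

Lemma compact_ptws_bool (I : choiceType) : compact [set: {ptws I -> bool}].
Proof.
have := @tychonoff I (fun=> bool) (fun=> setT) (fun=> bool_compact).
by congr (compact _); rewrite -subTset.
Qed.

Definition nbhs_code (X : topologicalType) (x : X) : {ptws set X -> bool} :=
  fun U => `[< nbhs x U >].

(** The family is upward closed.  This makes the relation between points and
their codes closed, which in general fails for the neighbourhood filters
alone. *)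
Definition nbhs_hull (X : topologicalType) : set {ptws set X -> bool} :=
  [set A | exists x : X, forall U, nbhs x U -> A U].
Arguments nbhs_hull : clear implicits.

Section NbhsHull.
Variable X : topologicalType.
Local Notation Z := (set_type (nbhs_hull X)).

Let code_mem (x : X) : nbhs_code x \in nbhs_hull X.
Proof. by rewrite inE; exists x => U xU; apply/asboolP. Qed.

Let code (x : X) : Z := exist _ (nbhs_code x) (code_mem x).

Let val_cts : continuous (set_val : Z -> {ptws set X -> bool}).
Proof. exact: initial_continuous. Qed.

Let cvg_hull (F : set_system Z) (z : Z) :
  Filter F ->
  (forall U, (fun z' : Z => set_val z' U) @ F --> set_val z U) -> F --> z.
Proof.
move=> FF Fz; apply: cvg_initial => //.
by apply: (@cvg_ptws _ _ (set_val @ F)) => U; exact: Fz.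
Qed.

Let coord_cts (U : set X) : continuous (fun z : Z => set_val z U).
Proof.
move=> z.
apply: (@continuous_comp _ _ _ _ (fun g : {ptws set X -> bool} => g U)).
  exact: val_cts.
exact: proj_ptws_continuous.
Qed.

Lemma accessible_nbhs_hull : accessible_space Z.
Proof.
apply: (@accessible_injective Z (set X) (fun=> bool) (fun U z => set_val z U)).
- by move=> _; exact: accessible_discrete.
- exact: coord_cts.
- by move=> z z' zz'; apply: val_inj; apply/funext.
Qed.

(** A set fixing one coordinate is clopen, and those sets generate the topology
of the cube. *)
Lemma zero_dimensional_nbhs_hull : X -> zero_dimensional_space Z.
Proof.
move=> x0; split; [by exists (code x0) | exact: accessible_nbhs_hull |].
exists clopen => //; split=> [A []//|z].
have FF : Filter (filter_from [set U : set Z | clopen U /\ U z] id).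
  apply: filter_from_filter; first by exists setT; split=> //; exact: clopenT.
  move=> A B [cA Az] [cB Bz]; exists (A `&` B) => //.
  by split=> //; exact: clopenI.
apply: cvg_hull => U V /nbhs_singleton Vz.
exists ((fun z' : Z => set_val z' U) @^-1` V) => //; split=> //.
apply: preimage_clopen => //.
by split; [exact: discrete_open | exact: discrete_closed].
Qed.

(** The map [phi] below is a section of the projection (x, y, A) |-> (A, y) from
the closed set of triples such that [A] contains all neighbourhoods of [x]. *)
Lemma quasi_lindelof_prod_nbhs_hull (Y : topologicalType) :
  quasi_lindelof (X * Y)%type -> quasi_lindelof (Z * Y)%type.
Proof.
move=> /(quasi_lindelof_prod_compact (@compact_ptws_bool (set X))).
have /choice[c cP] : forall z : Z, exists x : X,
    forall U, nbhs x U -> set_val z U.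
  by move=> z; have := set_valP z.
pose phi (p : Z * Y) := ((c p.1, p.2), set_val p.1).
apply: (@quasi_lindelof_pullback _ _ phi) => -[[x y] A].
have FF := filter_preimage_nbhs phi (x, y, A).
have Fphi : phi @ filter_from (nbhs (x, y, A)) (preimage phi) --> (x, y, A).
  by move=> N ?; exists N.
have [xA|/existsNP[U /not_implyP[xU AU]]] :=
    pselect (forall U, nbhs x U -> A U); [right|left].
  have AZ : A \in nbhs_hull X by rewrite inE; exists x.
  exists (exist _ A AZ, y); apply: cvg_prod.
    apply: cvg_initial.
    exact: cvg_comp Fphi cvg_snd.
  apply: (cvg_comp phi (fun q => q.1.2) Fphi).
  by apply: cvg_comp; [exact: cvg_fst|exact: cvg_snd].
(* If A misses a neighbourhood U of x, then every triple close to (x, y, A) has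
   the same defect, which no value of phi has. *)
exists [set q : X * Y * {ptws set X -> bool} | nbhs q.1.1 U /\ ~ q.2 U].
  exists ([set q : X * Y | nbhs q.1 U],
          [set B : {ptws set X -> bool} | ~ B U]) => //; split.
    exists ([set x : X | nbhs x U], setT) => //=; last by move=> ? [].
    by split; [exact: nbhs_interior | exact: filterT].
  apply: (@proj_ptws_continuous _ _ U A [set b : bool | ~ b]).
  apply: open_nbhs_nbhs; split => //; exact: discrete_open.
by move=> [z y'] /= [/cP].
Qed.

(** If the neighbourhood filter of [x] is contained in [A], then the codes close
to [A] are codes of points close to [x]: for [U] a neighbourhood of [x], a code
close to [A] contains [U], so that its point lies in [U].  This holds
coordinatewise in powers. *)
Lemma quasi_lindelof_ptws_nbhs_hull (I : Type) :
  quasi_lindelof {ptws I -> Z} -> quasi_lindelof {ptws I -> X}.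
Proof.
pose phi (f : {ptws I -> X}) : {ptws I -> Z} := fun i => code (f i).
apply: (@quasi_lindelof_pullback _ _ phi) => a; right.
have /choice[f fa] : forall i, exists x : X,
    forall U, nbhs x U -> set_val (a i) U.
  by move=> i; have := set_valP (a i).
have FF := filter_preimage_nbhs phi a.
exists f; apply: cvg_ptws => i U /fa aU.
exists [set b : {ptws I -> Z} | set_val (b i) U].
  2: by move=> g /asboolP/nbhs_singleton.
have aiU : nbhs (a i) [set z : Z | set_val z U].
  apply: (@coord_cts U (a i) [set b : bool | b]).
  by apply: open_nbhs_nbhs; split => //; exact: discrete_open.
exact: (@proj_ptws_continuous I Z i a _ aiU).
Qed.

End NbhsHull.

Theorem corollary6p3 :
  [<-> (forall X : topologicalType,
          productively_quasi_lindelof X -> powerfully_quasi_lindelof X);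
       (forall X : topologicalType,
          productively_lindelof X -> powerfully_lindelof X);
       (forall X : topologicalType,
          zero_dimensional_space X ->
          productively_lindelof X -> powerfully_lindelof X)].
Proof.
tfae=> [qpow X pX | pow X _ | pow X pX].
(* The factor X of the product with the nonempty Lindelof space bool is itself
   regular and T1. *)
- have [regX2 T1X2 _] := pX _ lindelof_bool.
  split.
  + exact/regular_ptws/(@regular_prodl X bool true).
  + exact/accessible_ptws/(@accessible_prodl X bool true).
  + by apply: qpow => Y /pX[].
- exact: pow.
(* Zero-dimensional spaces are nonempty, so the empty space, whose coding space
   is empty, is treated apart. *)
- have [[x0]|X0] := pselect (inhabited X); last first.
    apply/quasi_lindelof_family => I V _; exists set0; first exact: countable0.
    by move=> f; case: X0; split; exact: f 0.
  have [_ _] : powerfully_lindelof (set_type (nbhs_hull X)).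
    apply: pow; first exact: zero_dimensional_nbhs_hull.
    move=> Y LY; have [regY T1Y _] := LY; split.
    + by apply: regular_prod => //; exact: uniform_regular.
    + by apply: accessible_prod => //; exact: accessible_nbhs_hull.
    + exact/quasi_lindelof_prod_nbhs_hull/pX.
  exact: quasi_lindelof_ptws_nbhs_hull.
Qed.
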